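(* Let $n\in\mathbb{N}$. For almost all $A\in U(n)$ (with respect to Haar measure on $U(n)$) the set $\mathrm{Bi}(A)$ is finite.
   Context: $\mathbb{T}=\{z\in\mathbb{C}:|z|=1\}$. For $A\in U(n)$, $\mathrm{Bi}(A)=\{v=(v_1,\dots,v_n)\in\mathbb{T}^n: Av\in\mathbb{T}^n,\ v_1=1\}$. The set may be empty, in which case it counts as finite. *)

(* Defs.v *)
From HB Require Import structures.
From mathcomp Require Import all_boot all_order all_algebra.
From mathcomp Require Import complex.
From mathcomp Require Import all_classical all_reals all_analysis.
Set Implicit Arguments.
Unset Strict Implicit.
Unset Printing Implicit Defensive.
Import Order.TTheory GRing.Theory Num.Theory.
Import numFieldNormedType.Exports.
Local Open Scope classical_set_scope.
Local Open Scope ring_scope.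
Local Open Scope complex_scope.

(* [R[i]] carries no topology in the libraries: give it the one of the regular
   module [(R[i])^o], which is induced by the complex modulus. *)
HB.instance Definition _ (R : realType) :=
  NormedModule.copy R[i] (R[i])^o.

Definition unitary_set (R : realType) (n : nat) : set 'M[R[i]]_n :=
  [set A | A \is unitarymx].
Arguments unitary_set : clear implicits.

(* As a [set_type], U(n) gets the topology induced by the inclusion into the
   n x n complex matrices. *)
Definition unitary_group (R : realType) (n : nat) : Type := unitary_set R n.

Section UnitaryGroup.
Variables (R : realType) (n : nat).
Implicit Types A B : unitary_group R n.

HB.instance Definition _ := Topological.on (unitary_group R n).

Definition unitary_mx A : 'M[R[i]]_n := set_val A.

Lemma unitary_mxP A : unitary_mx A \is unitarymx.
Proof. exact: set_mem (valP A). Qed.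

Lemma unitary_mul_subproof A B :
  unitary_mx A *m unitary_mx B \in unitary_set R n.
Proof. exact/mem_set/mul_unitarymx/unitary_mxP/unitary_mxP. Qed.

Definition unitary_mul A B : unitary_group R n :=
  exist _ (unitary_mx A *m unitary_mx B) (unitary_mul_subproof A B).

Lemma unitary1_subproof : 1%:M \in unitary_set R n.
Proof. by apply/mem_set; apply/unitarymxP; rewrite trmx1 map_mx1 mulmx1. Qed.

Definition unitary1 : unitary_group R n := exist _ 1%:M unitary1_subproof.

HB.instance Definition _ := isPointed.Build (unitary_group R n) unitary1.

Definition borel_unitary := g_sigma_algebraType (@open (unitary_group R n)).
HB.instance Definition _ := Measurable.on borel_unitary.

(* U(n) is compact, so its Haar measure is taken normalized: the unique
   left-invariant Borel probability measure. *)
Definition is_haar (mu : probability borel_unitary R) : Prop :=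
  forall (A : unitary_group R n) (E : set borel_unitary),
    measurable E -> mu (unitary_mul A @` E) = mu E.

End UnitaryGroup.

Definition torus (R : realType) (n : nat) : set 'cV[R[i]]_n :=
  [set v | forall i, `|v i 0| = 1].

(* The dimension is n.+1 so that the first coordinate v_1 (index 0) exists. *)
Definition Bi (R : realType) (n : nat) (A : 'M[R[i]]_n.+1) :
    set 'cV[R[i]]_n.+1 :=
  [set v | torus v /\ torus (A *m v) /\ v 0 0 = 1].

(* Main.v *)
Require Import Defs.
From mathcomp Require Import all_boot all_order all_algebra.
From mathcomp Require Import complex.
From mathcomp Require Import all_classical all_reals all_analysis.
From mathcomp Require Import measurable_realfun zify ring lra.

(* Bi(A) lies in the n-dimensional torus {v in T^(n+1), v_1 = 1}, and the
   condition A v in T^(n+1) amounts to n real equations, so a covering argument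
   replaces Sard's theorem.  For fixed v, the set of A such that all entries of
   A v have squared modulus within O(1/K) of 1 has Haar measure O(K^-n): up to
   finitely many diagonal unitaries A v is close to (1, ..., 1), and the
   constraints can then be dropped one at a time, each at the price of a factor
   1/K, since K rotations in a coordinate plane move the constrained event to
   disjoint events of equal measure on which the other constraints persist.
   Cover the torus by O(K^n) cells of size O(1/K).  The expected number of
   cells whose centre v is in the above relation with A is bounded in K, so by
   Fatou's lemma its limit inferior is almost surely finite; but this number
   tends to infinity whenever Bi(A) is infinite. *)

Set Implicit Arguments.
Unset Strict Implicit.
Unset Printing Implicit Defensive.
Import Order.TTheory GRing.Theory Num.Theory.
Import numFieldNormedType.Exports.
Local Open Scope classical_set_scope.
Local Open Scope ring_scope.
Local Open Scope complex_scope.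
Local Notation re := complex.Re.
Local Notation im := complex.Im.

(** * Real estimates *)

Section RealEstimates.
Variable R : realType.
Implicit Types a b c s t u x y : R.

(* [circle_re t + i circle_im t = (1 + i t) / (1 - i t)], which runs over the
   right half of the unit circle for t in [-1, 1]; the sign in [net_re] and
   [net_im] below adds the left half. *)
Definition circle_re t : R := (1 - t ^+ 2) / (1 + t ^+ 2).
Definition circle_im t : R := 2 * t / (1 + t ^+ 2).

Lemma circle_param_norm t : circle_re t ^+ 2 + circle_im t ^+ 2 = 1.
Proof.
rewrite /circle_re /circle_im; field.
by apply/negP => /eqP; have := sqr_ge0 t; lra.
Qed.

(** The difference quotient is 2 (-(t + u)) / ((1 + t^2) (1 + u^2)), and |t + u| is below the
    denominator because 2 |t| <= 1 + t^2. *)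
Lemma circle_re_lip t u : `|circle_re t - circle_re u| <= 2 * `|t - u|.
Proof.
have t2 := sqr_ge0 t; have u2 := sqr_ge0 u.
have tu2 : 0 <= t ^+ 2 * u ^+ 2 by rewrite mulr_ge0.
have D0 : 0 < (1 + t ^+ 2) * (1 + u ^+ 2) by rewrite mulr_gt0//; lra.
have -> : circle_re t - circle_re u =
  (2 * (- (t + u)) / ((1 + t ^+ 2) * (1 + u ^+ 2))) * (t - u).
  rewrite /circle_re; field.
  by rewrite !gt_eqF//; lra.
rewrite normrM ler_wpM2r// ler_norml lter_pdivrMr// lter_pdivlMr//.
have := sqr_ge0 (t + 1); have := sqr_ge0 (t - 1).
have := sqr_ge0 (u + 1); have := sqr_ge0 (u - 1).
by rewrite !sqrrD !sqrrN; nra.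
Qed.

Lemma circle_im_lip t u : `|circle_im t - circle_im u| <= 2 * `|t - u|.
Proof.
have t2 := sqr_ge0 t; have u2 := sqr_ge0 u.
have tu2 : 0 <= t ^+ 2 * u ^+ 2 by rewrite mulr_ge0.
have D0 : 0 < (1 + t ^+ 2) * (1 + u ^+ 2) by rewrite mulr_gt0//; lra.
have -> : circle_im t - circle_im u =
  (2 * (1 - t * u) / ((1 + t ^+ 2) * (1 + u ^+ 2))) * (t - u).
  rewrite /circle_im; field.
  by rewrite !gt_eqF//; lra.
rewrite normrM ler_wpM2r// ler_norml lter_pdivrMr// lter_pdivlMr//.
have := sqr_ge0 (t + u); have := sqr_ge0 (t - u).
by rewrite !sqrrD !sqrrN; nra.
Qed.

Lemma circle_paramP x y : x ^+ 2 + y ^+ 2 = 1 -> 0 <= x ->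
  exists t, [/\ -1 <= t, t <= 1, x = circle_re t & y = circle_im t].
Proof.
move=> xy x0; have x1 : 0 < 1 + x by lra.
have y1 : y ^+ 2 <= 1 by have := sqr_ge0 x; lra.
have yb : `|y| <= 1.
  by rewrite -(@ler_pXn2r _ 2) ?nnegrE// expr1n real_normK// num_real.
have hd : 1 + (y / (1 + x)) ^+ 2 = 2 / (1 + x).
  have -> : 1 + (y / (1 + x)) ^+ 2 = ((1 + x) ^+ 2 + y ^+ 2) / (1 + x) ^+ 2.
    by field; rewrite gt_eqF.
  have -> : y ^+ 2 = (1 - x) * (1 + x) by nra.
  by field; rewrite gt_eqF.
(* This is the tangent of half the argument of x + i y; x >= 0 keeps it in [-1, 1]. *)
exists (y / (1 + x)); split.
- by rewrite lter_pdivlMr//; move: yb; rewrite ler_norml; lra.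
- by rewrite lter_pdivrMr//; move: yb; rewrite ler_norml; lra.
- rewrite /circle_re hd.
  have -> : 1 - (y / (1 + x)) ^+ 2 = 2 - (1 + (y / (1 + x)) ^+ 2) by ring.
  by rewrite hd; field; rewrite gt_eqF.
- rewrite /circle_im hd.
  by field; rewrite gt_eqF.
Qed.

Definition net_re k (i : 'I_(k.*2.+1) * bool) : R :=
  (-1) ^+ i.2 * circle_re ((i.1%:R - k%:R) / k%:R).
Definition net_im k (i : 'I_(k.*2.+1) * bool) : R :=
  (-1) ^+ i.2 * circle_im ((i.1%:R - k%:R) / k%:R).

Lemma net_norm k (i : 'I_(k.*2.+1) * bool) : net_re i ^+ 2 + net_im i ^+ 2 = 1.
Proof.
rewrite /net_re /net_im (exprMn _ _ (circle_re _)) (exprMn _ _ (circle_im _)).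
by rewrite sqrr_sign !mul1r circle_param_norm. Qed.

(** The parameters form a grid of step 1 / k in [-1, 1], and both coordinates are 2-Lipschitz in the
    parameter; points with x < 0 are handled through their opposites. *)
Lemma net_dense k x y : (0 < k)%N -> x ^+ 2 + y ^+ 2 = 1 ->
  exists i : 'I_(k.*2.+1) * bool,
    `|x - net_re i| <= 2 / k%:R /\ `|y - net_im i| <= 2 / k%:R.
Proof.
move=> k0 xy; have k0' : 0 < k%:R :> R by rewrite ltr0n.
have grid t : -1 <= t -> t <= 1 ->
    exists j : 'I_(k.*2.+1), `|t - (j%:R - k%:R) / k%:R| <= 1 / k%:R.
  move=> t1 t2.
  have z0 : 0 <= (t + 1) * k%:R by rewrite mulr_ge0 ?ler0n//; lra.
  (* Rounding down gives m <= 2 k, with equality at t = 1, hence [k.*2.+1] grid points. *)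
  have := truncn_itv z0; set m := Num.truncn _ => /andP[m1 m2].
  have mk : (m < k.*2.+1)%N.
    rewrite ltnS -(ler_nat R) (le_trans m1)// -mul2n natrM ler_wpM2r ?ler0n//; lra.
  exists (Ordinal mk) => /=.
  have -> : t - (m%:R - k%:R) / k%:R = ((t + 1) * k%:R - m%:R) / k%:R.
    by field; rewrite gt_eqF.
  rewrite normrM normfV (gtr0_norm k0') ler_wpM2r ?invr_ge0 ?ler0n//.
  by move: m2; rewrite -natr1 ger0_norm; lra.
have half (b : bool) x' y' : x' ^+ 2 + y' ^+ 2 = 1 -> 0 <= x' ->
    x = (-1) ^+ b * x' -> y = (-1) ^+ b * y' ->
    exists i : 'I_(k.*2.+1) * bool,
      `|x - net_re i| <= 2 / k%:R /\ `|y - net_im i| <= 2 / k%:R.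
  move=> /circle_paramP h /h[t [t1 t2 -> ->]] -> ->.
  have [j hj] := grid t t1 t2; exists (j, b).
  rewrite /net_re /net_im /= -!mulrBr !normrM !normrX !normrN1 !expr1n !mul1r.
  have -> : 2 / k%:R = 2 * (1 / k%:R) :> R by rewrite mul1r.
  split; [apply: (le_trans (circle_re_lip _ _))|
          apply: (le_trans (circle_im_lip _ _))]; by rewrite ler_wpM2l.
have [x0|x0] := leP 0 x.
- by apply: (half false x y) => //; rewrite expr0 mul1r.
- by apply: (half true (- x) (- y)); rewrite ?sqrrN ?expr1 ?mulN1r ?opprK//; lra.
Qed.

(* For a vector (a, b) of C^2 close to (1, 1), the squared modulus of the first
   coordinate of its rotation grows at speed at least 1 in the sine s of the
   angle. *)
Lemma rotation_expanding a1 a2 b1 b2 s c s' c' :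
  `|a1 - 1| <= 1/10 -> `|a2| <= 1/10 -> `|b1 - 1| <= 1/10 -> `|b2| <= 1/10 ->
  0 <= s -> s <= s' -> s' <= 1/10 ->
  0 <= c -> 0 <= c' -> c ^+ 2 + s ^+ 2 = 1 -> c' ^+ 2 + s' ^+ 2 = 1 ->
  s' - s <= ((c' * a1 + s' * b1) ^+ 2 + (c' * a2 + s' * b2) ^+ 2)
          - ((c * a1 + s * b1) ^+ 2 + (c * a2 + s * b2) ^+ 2).
Proof.
rewrite !ler_norml => /andP[a1l a1u] /andP[a2l a2u] /andP[b1l b1u] /andP[b2l b2u].
move=> s0 ss' s'1 c0 c'0 cs cs'.
set p := a1 ^+ 2 + a2 ^+ 2; set q := b1 ^+ 2 + b2 ^+ 2.
set r := a1 * b1 + a2 * b2.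
(* Here p and q are squared norms and r is a real inner product, so r is near 1 and q - p near 0.
   The term in r contributes at least 1.12 (s' - s), the term in q - p at least -0.1 (s' - s). *)
have -> : ((c' * a1 + s' * b1) ^+ 2 + (c' * a2 + s' * b2) ^+ 2)
          - ((c * a1 + s * b1) ^+ 2 + (c * a2 + s * b2) ^+ 2) =
   (s' ^+ 2 - s ^+ 2) * (q - p) + 2 * (c' * s' - c * s) * r.
  have e1 : c ^+ 2 = 1 - s ^+ 2 by lra.
  have e2 : c' ^+ 2 = 1 - s' ^+ 2 by lra.
  by rewrite /p /q /r; ring: e1 e2.
have qp : -1/2 <= q - p by rewrite /q /p; nra.
have r7 : 7/10 <= r by rewrite /r; nra.
have c9 : 9/10 <= c by nra.
have c'9 : 9/10 <= c' by nra.
have cc' : c - c' <= (s' - s) * (1/5).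
  have h : (c - c') * (c + c') = (s' - s) * (s' + s) by nra.
  nra.
have hcs : (s' - s) * (8/10) <= c' * s' - c * s.
  have -> : c' * s' - c * s = c' * (s' - s) - s * (c - c') by ring.
  nra.
have h1 : (s' - s) * (- (1/10)) <= (s' ^+ 2 - s ^+ 2) * (q - p).
  have -> : s' ^+ 2 - s ^+ 2 = (s' - s) * (s' + s) by ring.
  rewrite -mulrA ler_wpM2l ?subr_ge0//; nra.
nra.
Qed.

End RealEstimates.

(** * Borel sets of the unitary group *)

Section UnitaryMeasurability.
Variables (R : realType) (n : nat).
Notation U := (borel_unitary R n).

Lemma re_continuous : continuous (@re R : R[i] -> R).
Proof.
move=> z; apply/(@cvgrPdist_lt R R R[i] (nbhs z) (nbhs_filter z)) => e e0.
exists e%:C => /=; first by rewrite ltcR.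
move=> w /=; rewrite normc_def ltcR; apply: le_lt_trans.
rewrite !raddfB/= -sqrtr_sqr ler_sqrt ?addr_ge0 ?sqr_ge0// lerDl sqr_ge0//.
Qed.

Lemma im_continuous : continuous (@im R : R[i] -> R).
Proof.
move=> z; apply/(@cvgrPdist_lt R R R[i] (nbhs z) (nbhs_filter z)) => e e0.
exists e%:C => /=; first by rewrite ltcR.
move=> w /=; rewrite normc_def ltcR; apply: le_lt_trans.
rewrite !raddfB/= -sqrtr_sqr ler_sqrt ?addr_ge0 ?sqr_ge0// lerDr sqr_ge0//.
Qed.

Lemma entry_continuous i j :
  continuous (fun A : unitary_group R n => unitary_mx A i j).
Proof.
move=> A; apply: (@continuous_comp _ _ _ (@unitary_mx R n) (fun M => M i j)).
  exact: initial_continuous.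
exact: coord_continuous.
Qed.

Lemma continuous_measurable_unitary (f : unitary_group R n -> R) :
  continuous f -> measurable_fun setT (f : U -> R).
Proof.
move=> /continuousP cf; apply: (measurability _ (RGenOpens.measurableE R)).
move=> _ [_ [a [b ->] <-]]; rewrite setTI.
by apply: sub_sigma_algebra; exact/cf/interval_open.
Qed.

(** Stated on the two real coordinates, so that closure properties of real measurable functions
    apply. *)
Definition measurableC (f : U -> R[i]) :=
  measurable_fun setT (fun A => re (f A)) /\
  measurable_fun setT (fun A => im (f A)).

Lemma measurableC_entry i j : measurableC (fun A => unitary_mx A i j).
Proof.
split; apply: continuous_measurable_unitary => A;
  apply: (continuous_comp (@entry_continuous i j A));
  [exact: re_continuous|exact: im_continuous].
Qed.

Lemma measurableC_cst c : measurableC (cst c).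
Proof. by split; exact: measurable_cst. Qed.

Lemma reM (x y : R[i]) : re (x * y) = re x * re y - im x * im y.
Proof. by case: x; case: y. Qed.

Lemma imM (x y : R[i]) : im (x * y) = re x * im y + im x * re y.
Proof. by case: x; case: y. Qed.

Lemma measurableC_mul f g :
  measurableC f -> measurableC g -> measurableC (fun A => f A * g A).
Proof.
move=> [f1 f2] [g1 g2]; split.
- under eq_fun do rewrite reM.
  by apply: measurable_funB; exact: measurable_funM.
- under eq_fun do rewrite imM.
  by apply: measurable_funD; exact: measurable_funM.
Qed.

Lemma measurableC_sum (I : Type) (s : seq I) (f : I -> U -> R[i]) :
  (forall i, measurableC (f i)) -> measurableC (fun A => \sum_(i <- s) f i A).
Proof.
move=> mf; split.
- under eq_fun do rewrite raddf_sum.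
  by apply: measurable_sum => i; case: (mf i).
- under eq_fun do rewrite raddf_sum.
  by apply: measurable_sum => i; case: (mf i).
Qed.

(** The left factor [B] will be the inverse of a translation, so that translated events are covered
    too. *)
Lemma measurableC_mulmx (B : 'M[R[i]]_n) (v : 'cV[R[i]]_n) i :
  measurableC (fun A => (B *m (unitary_mx A *m v)) i 0).
Proof.
under eq_fun do rewrite mxE.
apply: measurableC_sum => j; under eq_fun do rewrite mxE.
apply: measurableC_mul; first exact: measurableC_cst.
apply: measurableC_sum => k.
by apply: measurableC_mul; [exact: measurableC_entry|exact: measurableC_cst].
Qed.

Definition sqnorm (z : R[i]) : R := re z ^+ 2 + im z ^+ 2.

Lemma measurable_sqnorm f : measurableC f ->
  measurable_fun setT (fun A => sqnorm (f A)).
Proof.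
by move=> [? ?]; apply: measurable_funD; exact: measurable_funX.
Qed.

Lemma measurable_abs_le (f : U -> R) (c e : R) : measurable_fun setT f ->
  measurable [set A | `|f A - c| <= e].
Proof.
move=> mf; rewrite -[X in measurable X]setTI.
apply: measurable_fun_le => //.
apply: (measurableT_comp (@normr_measurable R setT)).
by apply: measurable_funB.
Qed.

Lemma measurable_forall_fin (I : finType) (P : I -> set U) :
  (forall i, measurable (P i)) -> measurable [set A | forall i, P i A].
Proof.
move=> mP; rewrite (_ : [set A | _] = \bigcap_(i in [set: I]) P i).
  by apply: fin_bigcap_measurable => //; exact: finite_finset.
by apply/seteqP; split=> [A h i _|A h i]; exact: h.
Qed.

End UnitaryMeasurability.

(** * Small balls for the Haar measure *)

Section HaarPacking.
Variables (R : realType) (n : nat).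
Notation U := (borel_unitary R n).

Lemma unitary_inv_subproof (g : unitary_group R n) :
  invmx (unitary_mx g) \in unitary_set R n.
Proof.
apply/mem_set; rewrite /unitary_set/= invmx_unitary ?unitary_mxP//.
by rewrite trmxC_unitary unitary_mxP.
Qed.

Definition unitary_inv (g : unitary_group R n) : unitary_group R n :=
  exist _ (invmx (unitary_mx g)) (unitary_inv_subproof g).

Lemma unitary_mx_unit (g : unitary_group R n) : unitary_mx g \in unitmx.
Proof. exact/unitarymx_unit/unitary_mxP. Qed.

Lemma unitary_mulK g : cancel (unitary_mul g) (unitary_mul (unitary_inv g)).
Proof.
by move=> A; apply: val_inj => /=; rewrite /unitary_mx/= mulKmx ?unitary_mx_unit.
Qed.

Lemma unitary_mulVK g : cancel (unitary_mul (unitary_inv g)) (unitary_mul g).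
Proof.
by move=> A; apply: val_inj => /=; rewrite /unitary_mx/= mulKVmx ?unitary_mx_unit.
Qed.

(** Rewrites a translated event as a condition on A v, the form in which measurability and the
    constraints can be read off. *)
Lemma image_unitary_mul g (P : set 'cV[R[i]]_n) (v : 'cV[R[i]]_n) :
  unitary_mul g @` [set A | P (unitary_mx A *m v)] =
  [set A | P (unitary_mx (unitary_inv g) *m (unitary_mx A *m v))].
Proof.
have mulE h A : unitary_mx h *m (unitary_mx A *m v) =
    unitary_mx (unitary_mul h A) *m v by rewrite mulmxA.
apply/seteqP; split=> [_ [A PA <-]|A] /=; rewrite mulE.
  by rewrite unitary_mulK.
by exists (unitary_mul (unitary_inv g) A); last exact: unitary_mulVK.
Qed.

Variable mu : probability U R.
Hypothesis mu_haar : is_haar mu.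

(** By invariance the K disjoint translates all have the measure of [E], and their union fits into
    [F]. *)
Lemma haar_packing (K : nat) (g : 'I_K -> unitary_group R n) (E F : set U) :
  measurable E -> measurable F ->
  (forall m, measurable (unitary_mul (g m) @` E : set U)) ->
  trivIset setT (fun m => unitary_mul (g m) @` E : set U) ->
  (forall m, unitary_mul (g m) @` E `<=` F) ->
  (K%:R%:E * mu E <= mu F)%E.
Proof.
move=> mE mF mgE tgE gEF.
have -> : (K%:R%:E * mu E =
    mu (\big[setU/set0]_(m < K) (unitary_mul (g m) @` E)))%E.
  rewrite measure_semi_additive_ord//; last exact: bigsetU_measurable.
  rewrite (eq_bigr (fun=> mu E)); last by move=> m _; exact: mu_haar.
  by rewrite mule_natl sumr_const card_ord.
apply: le_measure; rewrite ?inE//; first exact: bigsetU_measurable.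
apply: (big_ind (fun X : set U => X `<=` F)) => //.
by move=> X Y XF YF A [/XF|/YF].
Qed.

End HaarPacking.

(** * Plane rotations and events near (1, ..., 1) *)

Section SmallBall.
Variables (R : realType) (n : nat).
Notation U := (borel_unitary R n).
Implicit Types (i j : 'I_n) (c s : R) (v w : 'cV[R[i]]_n).

(** For i != j and c^2 + s^2 = 1, this is the Givens rotation in the plane of coordinates i and
    j. *)
Definition rotation_mx i j c s : 'M[R[i]]_n :=
  \matrix_(k, l) if k == i then
                   if l == i then c%:C else if l == j then (- s)%:C else 0
                 else if k == j then
                   if l == i then s%:C else if l == j then c%:C else 0
                 else (k == l)%:R.

Lemma rotation_mxE i j c s m (W : 'M[R[i]]_(n, m)) k l : i != j ->
  (rotation_mx i j c s *m W) k l =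
  if k == i then c%:C * W i l - s%:C * W j l
  else if k == j then s%:C * W i l + c%:C * W j l else W k l.
Proof.
move=> ij; have ji : (j == i) = false by rewrite eq_sym (negbTE ij).
rewrite mxE; case: (eqVneq k i) => [->|ki]; [|case: (eqVneq k j) => [->|kj]].
- rewrite (bigD1 i)//= (bigD1 j)/= ?ji// big1 ?addr0.
    by rewrite !mxE !eqxx ji raddfN mulNr.
  by move=> p /andP[/negbTE pi /negbTE pj]; rewrite mxE eqxx pi pj mul0r.
- rewrite (bigD1 i)//= (bigD1 j)/= ?ji// big1 ?addr0.
    by rewrite !mxE !eqxx ji.
  by move=> p /andP[/negbTE pi /negbTE pj]; rewrite mxE eqxx ji pi pj mul0r.
- rewrite (bigD1 k)//= big1 ?addr0.
    by rewrite mxE (negbTE ki) (negbTE kj) eqxx mul1r.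
  move=> p pk; rewrite mxE (negbTE ki) (negbTE kj) eq_sym (negbTE pk).
  by rewrite mul0r.
Qed.

Lemma rotation_mxK i j c s m (W : 'M[R[i]]_(n, m)) :
  i != j -> c ^+ 2 + s ^+ 2 = 1 ->
  rotation_mx i j c s *m (rotation_mx i j c (- s) *m W) = W.
Proof.
move=> ij cs; have ji : (j == i) = false by rewrite eq_sym (negbTE ij).
have csC : c%:C ^+ 2 + s%:C ^+ 2 = 1 by rewrite -!rmorphXn -raddfD cs.
have csC' : c%:C ^+ 2 = 1 - s%:C ^+ 2 by rewrite -csC addrK.
apply/matrixP => k l; rewrite !rotation_mxE// !eqxx ji raddfN.
case: eqVneq => [->|ki]; first by ring: csC'.
by case: eqVneq => [->|kj] //; ring: csC'.
Qed.

(** The conjugate transpose is the rotation of opposite sine, so unitarity is [rotation_mxK] at the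
    identity matrix; the rest is a comparison of entries. *)
Lemma rotation_mx_unitary i j c s : i != j -> c ^+ 2 + s ^+ 2 = 1 ->
  rotation_mx i j c s \in unitary_set R n.
Proof.
move=> ij cs; have ji : (j == i) = false by rewrite eq_sym (negbTE ij).
apply/mem_set/unitarymxP.
apply: etrans (rotation_mxK 1%:M ij cs); rewrite mulmx1; congr (_ *m _).
apply/matrixP => k l; rewrite !mxE.
have conj_real (x : R) : Num.conj (x%:C) = x%:C.
  by rewrite conj_Creal// complex_real.
rewrite !(fun_if Num.conj) conjC_nat ?rmorph0 ?conj_real opprK.
case: (eqVneq k i) => [ki|ki]; case: (eqVneq l i) => [li|li];
  case: (eqVneq k j) => [kj|kj]; case: (eqVneq l j) => [lj|lj] //.
all: rewrite ?(eq_sym l k) ?ki ?li ?kj ?lj ?eqxx ?ji ?(negbTE ij) //.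
all: first [ by rewrite -ki -kj eqxx in ij
           | by rewrite -li -lj eqxx in ij
           | by rewrite (negbTE ki) | by rewrite (negbTE kj)
           | by rewrite eq_sym (negbTE li) | by rewrite eq_sym (negbTE lj) ].
Qed.

Definition rotation i j c s (ij : i != j) (cs : c ^+ 2 + s ^+ 2 = 1) :
  unitary_group R n := exist _ (rotation_mx i j c s) (rotation_mx_unitary ij cs).

Lemma rotation_inv_mul i j c s (ij : i != j) (cs : c ^+ 2 + s ^+ 2 = 1) w :
  unitary_mx (unitary_inv (rotation ij cs)) *m w = rotation_mx i j c (- s) *m w.
Proof.
rewrite /unitary_mx/= -[w in LHS](@rotation_mxK i j c s _ w)// mulKmx//.
exact: (unitary_mx_unit (rotation ij cs)).
Qed.

(** A box around (1, ..., 1) in which only the first k coordinates have a constrained modulus: k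
    decreases and eta grows as constraints are dropped. The [- 0] gives both box conditions the form
    of [measurable_abs_le]. *)
Definition shell k (eta delta : R) : set 'cV[R[i]]_n := [set w | forall j,
  [/\ `|re (w j 0) - 1| <= eta, `|im (w j 0) - 0| <= eta &
      (j < k)%N -> `|sqnorm (w j 0) - 1| <= delta]].

Definition thin_torus (delta : R) : set 'cV[R[i]]_n :=
  [set w | forall j, `|sqnorm (w j 0) - 1| <= delta].

Lemma measurable_shell k eta delta (B : 'M[R[i]]_n) v :
  measurable [set A : U | shell k eta delta (B *m (unitary_mx A *m v))].
Proof.
apply: measurable_forall_fin => j.
have [mre mim] := measurableC_mulmx B v j.
rewrite [X in measurable X](_ : _ =
  [set A : U | `|re ((B *m (unitary_mx A *m v)) j 0) - 1| <= eta] `&`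
  [set A : U | `|im ((B *m (unitary_mx A *m v)) j 0) - 0| <= eta] `&`
  (if (j < k)%N then
  [set A : U | `|sqnorm ((B *m (unitary_mx A *m v)) j 0) - 1| <= delta]
  else setT)).
  apply: measurableI; first by apply: measurableI; exact: measurable_abs_le.
  case: ifP => // _; apply: measurable_abs_le; exact: measurable_sqnorm.
apply/seteqP; split => A /=; first by case=> ? ? h; case: ifP => [/h|].
by case=> -[? ?]; case: ifP => // _ ?; split.
Qed.

Lemma measurable_shell1 k eta delta v :
  measurable [set A : U | shell k eta delta (unitary_mx A *m v)].
Proof.
by have := measurable_shell k eta delta 1%:M v; under eq_set do rewrite mul1mx.
Qed.

Lemma measurable_thin_torus delta v :
  measurable [set A : U | thin_torus delta (unitary_mx A *m v)].
Proof.
have mE j : measurable [set A : U |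
    `|sqnorm ((1%:M *m (unitary_mx A *m v)) j 0) - 1| <= delta].
  apply: measurable_abs_le; apply: measurable_sqnorm.
  exact: measurableC_mulmx.
have := measurable_forall_fin mE; congr (measurable _).
by apply/seteqP; split=> A h j; have := h j; rewrite /= mul1mx.
Qed.

(** As 1 - s <= c <= 1, real and imaginary parts move by at most 3 s0. The first k coordinates are
    fixed and keep their constraints; coordinate i = k loses its own, and j > k carries none. *)
Lemma rotation_mx_shell i j c s s0 k eta delta w : (i < j)%N -> i = k :> nat ->
  0 <= s <= s0 -> 0 <= c -> c ^+ 2 + s ^+ 2 = 1 ->
  0 <= eta -> eta + 3 * s0 <= 1 / 10 ->
  shell k.+1 eta delta w ->
  shell k (eta + 3 * s0) delta (rotation_mx i j c s *m w).
Proof.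
move=> ltij ik /andP[s_ge0 ss0] c0 cs eta0 etas0 hw l.
have ij : i != j by rewrite neq_ltn ltij.
have c1 : 1 - s <= c by nra.
have c2 : c <= 1 by nra.
have [ri ii _] := hw i; have [rj ij' _] := hw j; have [rl il nl] := hw l.
rewrite rotation_mxE//.
have reB z1 z2 : re (z1 - z2) = re z1 - re z2 :> R by case: z1; case: z2.
have imB z1 z2 : im (z1 - z2) = im z1 - im z2 :> R by case: z1; case: z2.
have reD z1 z2 : re (z1 + z2) = re z1 + re z2 :> R by case: z1; case: z2.
have imD z1 z2 : im (z1 + z2) = im z1 + im z2 :> R by case: z1; case: z2.
have reR (x : R) z : re (x%:C * z) = x * re z by rewrite reM mul0r subr0.
have imR (x : R) z : im (x%:C * z) = x * im z by rewrite imM mul0r addr0.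
move: ri ii rj ij' rl il; rewrite !subr0 !ler_norml.
move=> /andP[? ?] /andP[? ?] /andP[? ?] /andP[? ?] /andP[? ?] /andP[? ?].
case: (eqVneq l i) => [li|_]; [|case: (eqVneq l j) => [lj|_]].
- split; last by rewrite li ik ltnn.
  + by rewrite reB !reR; apply/andP; split; nra.
  + by rewrite imB !imR; apply/andP; split; nra.
- split; last by rewrite lj -ik ltnNge ltnW.
  + by rewrite reD !reR; apply/andP; split; nra.
  + by rewrite imD !imR; apply/andP; split; nra.
- split; last by move=> lk; rewrite -ler_norml; apply: nl; rewrite ltnS ltnW.
  + by apply/andP; split; lra.
  + by apply/andP; split; lra.
Qed.

End SmallBall.

(** * Haar measure of shells and reduction of thin tori to shells *)

Section HaarShell.
Variables (R : realType) (n : nat).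
Notation U := (borel_unitary R n).
Implicit Types (i j : 'I_n) (c s : R) (v w : 'cV[R[i]]_n).
Variable mu : probability U R.
Hypothesis mu_haar : is_haar mu.

(* The K rotations of sine m s0 / K (m < K) in the (i, j)-plane fix the first k
   coordinates and keep the vector close to (1, ..., 1), hence map the smaller
   event into the larger one; by [rotation_expanding] the images are pairwise
   disjoint, as delta is a third of the step s0 / K. *)
Lemma shell_step i j k K s0 eta delta v : (i < j)%N -> i = k :> nat ->
  (0 < K)%N -> 0 < s0 -> 0 <= eta -> eta + 3 * s0 <= 1 / 10 ->
  delta = s0 / (3 * K%:R) ->
  (K%:R%:E * mu [set A : U | shell k.+1 eta delta (unitary_mx A *m v)] <=
   mu [set A : U | shell k (eta + 3 * s0) delta (unitary_mx A *m v)])%E.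
Proof.
move=> ltij ik K0 s0_gt0 eta0 etas0 deltaE.
have ij : i != j by rewrite neq_ltn ltij.
have K0' : 0 < K%:R :> R by rewrite ltr0n.
pose s (m : 'I_K) : R := m%:R * (s0 / K%:R).
pose c (m : 'I_K) : R := Num.sqrt (1 - s m ^+ 2).
have h0 : 0 < s0 / K%:R by rewrite divr_gt0.
have s_ge0 m : 0 <= s m by rewrite mulr_ge0// ltW.
have s_le m : s m <= s0.
  rewrite /s mulrCA ler_piMr ?(ltW s0_gt0)// ler_pdivrMr// mul1r ler_nat ltnW//.
have c_ge0 m : 0 <= c m by rewrite sqrtr_ge0.
have cs m : c m ^+ 2 + s m ^+ 2 = 1.
  by rewrite sqr_sqrtr ?subrK// subr_ge0; have := s_ge0 m; have := s_le m; nra.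
pose g m := rotation ij (cs m).
have imgE m : unitary_mul (g m) @`
    [set A : U | shell k.+1 eta delta (unitary_mx A *m v)] =
    [set A : U | shell k.+1 eta delta
                   (unitary_mx (unitary_inv (g m)) *m (unitary_mx A *m v))].
  exact: (image_unitary_mul (g m) (shell k.+1 eta delta) v).
have img_sub m : unitary_mul (g m) @`
    [set A : U | shell k.+1 eta delta (unitary_mx A *m v)] `<=`
    [set A : U | shell k (eta + 3 * s0) delta (unitary_mx A *m v)].
  move=> _ [A /= hA <-]; rewrite -mulmxA.
  by apply: rotation_mx_shell => //; rewrite s_ge0 s_le.
apply: (haar_packing mu_haar (g := g)) => //.
- exact: measurable_shell1.
- exact: measurable_shell1.
- by move=> m; rewrite imgE; exact: measurable_shell.
suff disj (m m' : 'I_K) A : (m <= m')%N ->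
    (unitary_mul (g m) @`
      [set A : U | shell k.+1 eta delta (unitary_mx A *m v)]) A ->
    (unitary_mul (g m') @`
      [set A : U | shell k.+1 eta delta (unitary_mx A *m v)]) A -> m = m'.
  move=> m m' _ _ [A [Am Am']].
  by have [mm'|/ltnW mm'] := leqP m m'; [|symmetry]; apply: (disj _ _ A).
move=> mm' Am Am'.
(* A common point of two images lies in the larger event, so A v is close to (1, ..., 1) and
   [rotation_expanding] applies to its coordinates i and j. Undoing the rotations turns - s into s
   in the first coordinate. *)
have hz := img_sub _ _ Am; move: Am Am'; rewrite !imgE /= !rotation_inv_mul.
set z := unitary_mx A *m v in hz *.
have sqE p : sqnorm ((rotation_mx i j (c p) (- s p) *m z) i 0) =
    (c p * re (z i 0) + s p * re (z j 0)) ^+ 2 +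
    (c p * im (z i 0) + s p * im (z j 0)) ^+ 2.
  rewrite rotation_mxE// eqxx /sqnorm.
  by case: (z i 0) => a1 a2; case: (z j 0) => b1 b2 /=; ring.
move=> /(_ i)[_ _] + /(_ i)[_ _]; rewrite ik ltnSn => /(_ isT) + /(_ isT).
rewrite !sqE => hm hm'.
have [zi1 zi2 _] := hz i; have [zj1 zj2 _] := hz j.
rewrite !subr0 in zi2 zj2.
have le10 x : x <= eta + 3 * s0 -> x <= 1 / 10 by move=> /le_trans; exact.
have ss' : s m <= s m' by rewrite ler_wpM2r ?ler_nat// ltW.
have s'10 : s m' <= 1 / 10 by apply: (le_trans (s_le m')); lra.
have := rotation_expanding (le10 _ zi1) (le10 _ zi2) (le10 _ zj1) (le10 _ zj2)
  (s_ge0 m) ss' s'10 (c_ge0 m) (c_ge0 m') (cs m) (cs m').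
move: hm hm'; rewrite !ler_norml => /andP[h1 h2] /andP[h3 h4] h5.
(* Both squared moduli are within delta of 1, so the sines differ by at most 2 delta, less than one
   step. *)
have h6 : (m'%:R - m%:R) * (s0 / K%:R) <= 2 * delta 
  by rewrite mulrBl -/(s m) -/(s m'); lra.
have d3 : 2 * delta < s0 / K%:R.
  have -> : 2 * delta = 2 / 3 * (s0 / K%:R) by rewrite deltaE; field; rewrite gt_eqF.
  lra.
have : (m'%:R - m%:R) * (s0 / K%:R) < 1 * (s0 / K%:R).
  by rewrite mul1r; exact: le_lt_trans d3.
rewrite ltr_pM2r// ltrBlDr nat1r ltr_nat ltnS => m'm.
by apply/val_inj/eqP; rewrite eqn_leq mm' m'm.
Qed.

(** Each constraint dropped by [shell_step] yields one factor K. The last constrained coordinate is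
    rotated against the next one, which must exist: hence k < n. *)
Lemma shell_small K s0 delta v : (0 < K)%N -> 0 < s0 -> delta = s0 / (3 * K%:R) ->
  forall k eta, (k < n)%N -> 0 <= eta -> eta + 3 * s0 * k%:R <= 1 / 10 ->
  ((K ^ k)%:R%:E * mu [set A : U | shell k eta delta (unitary_mx A *m v)] <= 1)%E.
Proof.
move=> K0 s0_gt0 deltaE; elim=> [|k IH] eta kn eta0 etak.
  by rewrite expn0 mul1e; apply: probability_le1; exact: measurable_shell1.
rewrite expnSr natrM EFinM -muleA.
have kn' := ltnW kn.
have step := @shell_step (Ordinal kn') (Ordinal kn) k K s0 eta delta v
  (ltnSn k) erefl K0 s0_gt0 eta0 _ deltaE.
have k0 : 0 <= k%:R :> R by [].
have etas : eta + 3 * s0 <= 1 / 10 by move: etak; rewrite -natr1; nra.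
have IHk := IH (eta + 3 * s0) kn' ltac:(lra)
  ltac:(move: etak; rewrite -natr1; lra).
apply: le_trans IHk; apply: lee_wpmul2l; first by rewrite lee_fin.
exact: step.
Qed.

Definition net_pt k (i : 'I_(k.*2.+1) * bool) : R[i] := net_re R i +i* net_im R i.

Lemma conjc_net_pt k (i : 'I_(k.*2.+1) * bool) : net_pt i * (net_pt i)^*%R = 1.
Proof.
by rewrite -normCK normc_def -rmorphXn /= sqr_sqrtr ?net_norm.
Qed.

Definition net_diag_mx k (f : {ffun 'I_n -> 'I_(k.*2.+1) * bool}) : 'M[R[i]]_n :=
  diag_mx (\row_j net_pt (f j)).

Lemma net_diag_mx_unitary k f : @net_diag_mx k f \in unitary_set R n.
Proof.
apply/mem_set/unitarymxP.
rewrite /net_diag_mx tr_diag_mx map_diag_mx mulmx_diag -diag_const_mx.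
by congr diag_mx; apply/rowP => j; rewrite !mxE conjc_net_pt.
Qed.

Definition net_diag k f : unitary_group R n :=
  exist _ (@net_diag_mx k f) (net_diag_mx_unitary f).

Lemma net_diag_invE k f w j :
  (unitary_mx (unitary_inv (@net_diag k f)) *m w) j 0 = (net_pt (f j))^*%R * w j 0.
Proof.
have -> : unitary_mx (unitary_inv (net_diag f)) =
    map_mx Num.conj (net_diag_mx f)^T.
  exact: (invmx_unitary (set_mem (net_diag_mx_unitary f))).
by rewrite tr_diag_mx map_diag_mx mul_diag_mx !mxE.
Qed.

(** Each coordinate of w is close to the unit circle, hence to a net point; dividing by that net
    point brings it close to 1 and preserves its modulus. *)
Lemma thin_torus_shell k delta w : (200 <= k)%N -> delta <= 1 / 180 ->
  thin_torus delta w -> exists f : {ffun 'I_n -> 'I_(k.*2.+1) * bool},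
    shell n (1 / 20) delta (unitary_mx (unitary_inv (net_diag f)) *m w).
Proof.
move=> k200 d180 hw.
have k0 : (0 < k)%N by exact: leq_trans k200.
have k2 : 2 / k%:R <= 1 / 100 :> R.
  rewrite ler_pdivrMr ?ltr0n//; have : 200%:R <= k%:R :> R by rewrite ler_nat.
  by lra.
(* Going radially to the circle costs 1 / 180 and on to the net 2 / k <= 1 / 100, in each real
   coordinate. Division by the net point adds two such errors, which gives 1 / 20. *)
have num : 1 / 180 + 1 / 100 <= 1 / 40 :> R by lra.
have near_net j : exists i : 'I_(k.*2.+1) * bool,
    `|re (w j 0) - net_re R i| <= 1 / 40 /\ `|im (w j 0) - net_im R i| <= 1 / 40.
  have := hw j; rewrite /sqnorm; move: (w j 0) => [x y] /= hxy.
  pose r := Num.sqrt (x ^+ 2 + y ^+ 2).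
  have xy0 : 0 <= x ^+ 2 + y ^+ 2 by rewrite addr_ge0 ?sqr_ge0.
  have r2 : r ^+ 2 = x ^+ 2 + y ^+ 2 by rewrite sqr_sqrtr.
  have r0 : 0 <= r by exact: sqrtr_ge0.
  move: hxy; rewrite -r2 ler_norml => /andP[h1 h2].
  have rgt : 0 < r by nra.
  have r1 : `|r - 1| <= 1 / 180 by rewrite ler_norml; apply/andP; split; nra.
  have unit_xy : (x / r) ^+ 2 + (y / r) ^+ 2 = 1.
    by rewrite !expr_div_n -mulrDl -r2 divff// sqrf_eq0 gt_eqF.
  have [i [hx hy]] := net_dense k0 unit_xy; exists i.
  have close (z : R) : `|z / r| <= 1 -> `|z - z / r| <= 1 / 180.
    move=> z1; have -> : z - z / r = z / r * (r - 1) by field; rewrite gt_eqF.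
    by rewrite normrM -[leRHS]mul1r ler_pM.
  have le1 (z z' : R) : z ^+ 2 + z' ^+ 2 = 1 -> `|z| <= 1.
    move=> zz; rewrite -(@ler_pXn2r _ 2) ?nnegrE// expr1n real_normK ?num_real//.
    by have := sqr_ge0 z'; lra.
  have cx := close _ (le1 _ _ unit_xy).
  have cy : `|y - y / r| <= 1 / 180.
    by apply: close; apply: (le1 _ (x / r)); rewrite addrC.
  split; apply: le_trans (ler_distD _ _ _) (le_trans _ num).
    by apply: lerD cx (le_trans hx k2).
  by apply: lerD cy (le_trans hy k2).
have [f hf] := choice near_net.
exists (finfun f) => j; rewrite net_diag_invE ffunE.
have [] := hf j; have := hw j; have := net_norm R (f j).
have -> : (net_pt (f j))^*%R = net_re R (f j) -i* net_im R (f j) by [].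
rewrite /sqnorm; move: (net_re R (f j)) (net_im R (f j)) => p q.
case: (w j 0) => x y /= pq hxy hx hy.
have p1 : `|p| <= 1 by rewrite ler_norml; apply/andP; split; nra.
have q1 : `|q| <= 1 by rewrite ler_norml; apply/andP; split; nra.
have bound (a b : R) : `|a| <= 1 -> `|b| <= 1 / 40 -> `|a * b| <= 1 / 40.
  by move=> ? ?; rewrite normrM -[leRHS]mul1r ler_pM.
split; last 1 first.
- move=> _; suff -> : (p * x - - q * y) ^+ 2 + (p * y + - q * x) ^+ 2 =
      x ^+ 2 + y ^+ 2 by [].
  by rewrite -[RHS]mul1r -pq; ring.
- have -> : p * x - - q * y - 1 = p * (x - p) + q * (y - q).
    by rewrite -pq; ring.
  apply: le_trans (ler_normD _ _) _.
  by have := bound _ _ p1 hx; have := bound _ _ q1 hy; lra.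
- have -> : p * y + - q * x - 0 = p * (y - q) + - (q * (x - p)) by ring.
  apply: le_trans (ler_normD _ _) _; rewrite normrN.
  by have := bound _ _ p1 hy; have := bound _ _ q1 hx; lra.
Qed.

End HaarShell.

(** * Union bound over a finite type *)

Section FiniteUnionBound.
Context d (T : measurableType d) (R : realType) (mu : {measure set T -> \bar R}).

Lemma measure_bigcup_fin_le (I : finType) (F : I -> set T) (A : set T) :
  measurable A -> (forall i, measurable (F i)) ->
  (forall x, A x -> exists i, F i x) ->
  (mu A <= \sum_(i : I) mu (F i))%E.
Proof.
move=> mA mF AF.
have [mU leU] : measurable (\big[setU/set0]_(i : I) F i) /\
    (mu (\big[setU/set0]_(i : I) F i) <= \sum_(i : I) mu (F i))%E.
  apply: (big_ind2 (fun (X : set T) r => measurable X /\ (mu X <= r)%E)).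
  - by rewrite measure0.
  - move=> X r Y s [mX Xr] [mY Ys]; split; first exact: measurableU.
    by apply: le_trans (leeD Xr Ys); exact: measureU2.
  - by move=> i _; split.
apply: le_trans leU; apply: le_measure; rewrite ?inE//.
by move=> x /AF[i Fix]; rewrite (bigD1 i)//=; left.
Qed.

End FiniteUnionBound.

(** * Measure of thin tori and nets adapted to [Bi] *)

Section ThinTorus.
Variables (R : realType) (n : nat).
Notation U := (borel_unitary R n.+1).
Implicit Types (v w : 'cV[R[i]]_n.+1).

(* This is s0 / (3 K) in [shell_step], with s0 = 1 / (60 (n + 1)) so that n
   steps starting from eta = 1 / 20 stay below 1 / 10. *)
Definition thickness K : R := 1 / (180 * n.+1%:R * K%:R).

Lemma thickness_le K : (0 < K)%N -> thickness K <= 1 / 180.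
Proof.
move=> K0; rewrite /thickness !mul1r lef_pV2 ?posrE ?mulr_gt0 ?ltr0n//.
by rewrite -mulrA ler_peMr// mulr_ege1 ?ler1n.
Qed.

(** The event is covered by translates of one shell by diagonal unitaries, each of measure at most
    K^-n. Their number C depends neither on K nor on v, which makes the expected count bounded
    later. *)
Lemma thin_torus_measure : exists C : R, 0 <= C /\
  forall (mu : probability U R), is_haar mu -> forall K v, (0 < K)%N ->
  (mu [set A : U | thin_torus (thickness K) (unitary_mx A *m v)] <=
   ((K%:R ^+ n)^-1 * C)%:E)%E.
Proof.
exists #|{ffun 'I_n.+1 -> 'I_(200.*2.+1) * bool}|%:R; split => //.
move=> mu mu_haar K v K0.
have K0' : 1 <= K%:R :> R by rewrite ler1n.
have n0 : 1 <= n.+1%:R :> R by rewrite ler1n.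
set delta := thickness K.
have delta180 : delta <= 1 / 180 by exact: thickness_le.
(* Coordinates 0 to n - 1 are constrained in modulus, and coordinate n serves as a rotation partner;
   the exponent n matches the dimension of the torus v_1 = 1. *)
pose E := [set A : U | shell n (1 / 20) delta (unitary_mx A *m v)].
have mE : measurable E by exact: measurable_shell1.
have small : ((K%:R ^+ n)%:E * mu E <= 1)%E.
  rewrite -natrX; apply: (@shell_small _ _ mu mu_haar K (1 / (60 * n.+1%:R))) => //.
  - rewrite /delta /thickness; field.
    by rewrite !gt_eqF//; lra.
  - have -> : 3 * (1 / (60 * n.+1%:R)) * n%:R = n%:R / n.+1%:R / 20 :> R.
      by field; rewrite nat1r gt_eqF.
    have : n%:R / n.+1%:R <= 1 :> R by rewrite ler_pdivrMr ?mul1r ?ler_nat//; lra.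
    set t := n%:R / n.+1%:R; lra.
rewrite EFinM lee_pdivlMl ?exprn_gt0//; last by lra.
pose F (f : {ffun 'I_n.+1 -> 'I_(200.*2.+1) * bool}) : set U :=
  unitary_mul (net_diag R f) @` E.
have FE f : F f = [set A : U | shell n (1 / 20) delta
    (unitary_mx (unitary_inv (net_diag R f)) *m (unitary_mx A *m v))].
  exact: (image_unitary_mul (net_diag R f) (shell n (1 / 20) delta) v).
have muF f : mu (F f) = mu E by exact: mu_haar.
apply: (@le_trans _ _ ((K%:R ^+ n)%:E * \sum_f mu (F f))%E).
  apply: lee_wpmul2l; first by rewrite lee_fin exprn_ge0//; lra.
  apply: measure_bigcup_fin_le; first exact: measurable_thin_torus.
    by move=> f; rewrite FE; exact: measurable_shell.
  move=> A /(@thin_torus_shell _ _ 200 _ _ isT delta180)[f hf]; exists f.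
  rewrite FE => j; have [h1 h2 h3] := hf j; split => // jn; apply: h3.
  exact: ltn_ord.
rewrite (eq_bigr (fun=> mu E))//.
set X := #|_|.
have -> : (\sum_(f : {ffun 'I_n.+1 -> 'I_(200.*2.+1) * bool}) mu E =
    X%:R%:E * mu E)%E by rewrite mule_natl sumr_const.
rewrite muleCA -[leRHS]mule1.
by apply: lee_wpmul2l; rewrite ?lee_fin.
Qed.

(** Rows of a unitary matrix have norm 1, so the entries have real and imaginary parts at most 1;
    each of the n + 1 products then contributes two terms bounded by e. *)
Lemma mulmx_coord_le (A : 'M[R[i]]_n.+1) (w : 'cV[R[i]]_n.+1) e j :
  A \is unitarymx -> (forall i, `|re (w i 0)| <= e /\ `|im (w i 0)| <= e) ->
  `|re ((A *m w) j 0)| <= 2 * n.+1%:R * e /\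
  `|im ((A *m w) j 0)| <= 2 * n.+1%:R * e.
Proof.
move=> /unitarymxP uA hw.
have Ale i : `|re (A j i)| <= 1 /\ `|im (A j i)| <= 1.
  have : re ((A *m map_mx Num.conj A^T) j j) = 1.
    by rewrite uA mxE eqxx.
  rewrite mxE raddf_sum (bigD1 i)//= => h.
  have sq k : re (A j k * (map_mx Num.conj A^T) k j) = sqnorm (A j k).
    rewrite !mxE; have -> : (A j k)^*%R = conjc (A j k) by [].
    by rewrite /sqnorm; case: (A j k) => x y /=; ring.
  rewrite sq (eq_bigr (fun k => sqnorm (A j k))) in h; last by move=> k _; exact: sq.
  have : 0 <= \sum_(k | k != i) sqnorm (A j k).
    by apply: sumr_ge0 => k _; rewrite addr_ge0 ?sqr_ge0.
  move: h; rewrite /sqnorm; set x := re _; set y := im _ => h1 h2.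
  by have := sqr_ge0 x; have := sqr_ge0 y; rewrite !ler_norml; split;
    apply/andP; split; nra.
have e2 : 2 * n.+1%:R * e = \sum_(i < n.+1) (e + e).
  by rewrite sumr_const card_ord -mulr_natl; ring.
have le1 (x y : R) : `|x| <= 1 -> `|y| <= e -> `|x * y| <= e.
  by move=> ? ?; rewrite normrM -[leRHS]mul1r ler_pM.
split; rewrite mxE raddf_sum e2; apply: le_trans (ler_norm_sum _ _ _) _;
  apply: ler_sum => i _; have [a1 a2] := Ale i; have [w1 w2] := hw i.
- rewrite /= reM; apply: le_trans (ler_normB _ _) _.
  by apply: lerD; exact: le1.
- rewrite /= imM; apply: le_trans (ler_normD _ _) _.
  by apply: lerD; exact: le1.
Qed.

Lemma torus_sqnorm w j : torus w -> sqnorm (w j 0) = 1.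
Proof.
move=> /(_ j) h; apply: complexI.
by rewrite /sqnorm add_Re2_Im2 h expr1n.
Qed.

(** Coordinate 0 is pinned to 1 as in [Bi], so that n net points determine a cell and the number of
    cells grows like k^n. *)
Definition net_vec k (f : {ffun 'I_n -> 'I_(k.*2.+1) * bool}) : 'cV[R[i]]_n.+1 :=
  \col_i if unlift ord0 i is Some j then net_pt R (f j) else 1.

Lemma Bi_net_vec k (A : 'M[R[i]]_n.+1) w : (0 < k)%N -> Bi A w ->
  exists f : {ffun 'I_n -> 'I_(k.*2.+1) * bool},
  forall i, `|re (w i 0 - net_vec f i 0)| <= 2 / k%:R /\
            `|im (w i 0 - net_vec f i 0)| <= 2 / k%:R.
Proof.
move=> k0 [tw [_ w0]].
have [f hf] := choice (fun j => net_dense k0 (torus_sqnorm (lift ord0 j) tw)).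
exists (finfun f) => i; rewrite mxE; case: unliftP => [j ->|->].
  by rewrite ffunE !raddfB; exact: hf.
by rewrite w0 subrr raddf0 raddf0 normr0; split; rewrite divr_ge0.
Qed.

(* Chosen so that moving v by 2 / mesh in each real coordinate moves the squared
   moduli of the entries of A v by at most [thickness]. *)
Definition mesh K := (4320 * n.+1 ^ 2 * K)%N.

Lemma thin_torus_net_vec K (A : 'M[R[i]]_n.+1) w w' : (0 < K)%N ->
  A \is unitarymx -> Bi A w ->
  (forall i, `|re (w i 0 - w' i 0)| <= 2 / (mesh K)%:R /\
             `|im (w i 0 - w' i 0)| <= 2 / (mesh K)%:R) ->
  thin_torus (thickness K) (A *m w').
Proof.
move=> K0 uA [_ [tAw _]] hw j.
have K0' : 1 <= K%:R :> R by rewrite ler1n.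
have n0 : 1 <= n.+1%:R :> R by rewrite ler1n.
have hd i : `|re ((w - w') i 0)| <= 2 / (mesh K)%:R /\
            `|im ((w - w') i 0)| <= 2 / (mesh K)%:R.
  by have := hw i; rewrite !mxE.
have [] := mulmx_coord_le j uA hd.
set e := 2 * _ * _.
(* Here e = 1 / (1080 (n + 1) K). The factor 6 accounts for the expansion below: two doubled
   products bounded by 2 e each, and two squares bounded by e each since e <= 1. *)
have e6 : 6 * e = thickness K.
  rewrite /e /thickness /mesh !natrM; field.
  by rewrite !gt_eqF//; lra.
have e1 : e <= 1.
  by have := thickness_le K0; lra.
have sq1 := torus_sqnorm j tAw.
rewrite -e6 mulmxBr [((_ - _)%R : matrix _ _ _) _ _]mxE.
rewrite [(- _ : matrix _ _ _) _ _]mxE.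
move: sq1; rewrite /sqnorm.
case: ((A *m w) j 0) => x1 x2; case: ((A *m w') j 0) => y1 y2 /=.
move=> sq1; rewrite !ler_norml => /andP[? ?] /andP[? ?].
have x1b : -1 <= x1 <= 1 by apply/andP; split; nra.
have x2b : -1 <= x2 <= 1 by apply/andP; split; nra.
move: x1b x2b => /andP[? ?] /andP[? ?].
have -> : y1 ^+ 2 + y2 ^+ 2 - 1 =
    - (x1 * (x1 - y1)) *+ 2 - (x2 * (x2 - y2)) *+ 2 +
    (x1 - y1) ^+ 2 + (x2 - y2) ^+ 2.
  by rewrite -sq1; ring.
have [? ?] : - e <= x1 * (x1 - y1) /\ x1 * (x1 - y1) <= e by split; nra.
have [? ?] : - e <= x2 * (x2 - y2) /\ x2 * (x2 - y2) <= e by split; nra.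
have ? : (x1 - y1) ^+ 2 <= e by nra.
have ? : (x2 - y2) ^+ 2 <= e by nra.
have := sqr_ge0 (x1 - y1); have := sqr_ge0 (x2 - y2).
by move=> ? ?; apply/andP; split; lra.
Qed.

End ThinTorus.

(** * Counting cells *)

(** By Fatou's lemma the limit inferior has integral at most M, so it is almost everywhere finite,
    whereas convergence to +oo would make it +oo. *)
Lemma ae_not_cvg_pinfty d (T : measurableType d) (R : realType)
    (mu : {measure set T -> \bar R}) (f : nat -> T -> \bar R) (M : R) :
  (forall k, measurable_fun setT (f k)) -> (forall k x, (0 <= f k x)%E) ->
  (forall k, (\int[mu]_x f k x <= M%:E)%E) ->
  {ae mu, forall x, ~ (f^~ x @ \oo --> +oo%E)}.
Proof.
move=> mf f0 fM.
have einf0 x : (0 <= limn_einf (f^~ x))%E.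
  rewrite limn_einf_lim; apply: lime_ge; first exact: is_cvg_einfs.
  by apply: nearW => k; apply: le_ereal_inf_tmp => _ [m _ <-]; exact: f0.
have intf : mu.-integrable setT (fun x => limn_einf (f^~ x)).
  apply/integrableP; split.
    (* The limit inferior is the opposite of the limit superior of the opposites. *)
    apply: measurableT_comp => //; apply: measurable_fun_limn_esup => k.
    exact: measurableT_comp.
  under eq_integral do rewrite gee0_abs//.
  apply: le_lt_trans (ltry M).
  apply: le_trans (fatou _ _ _ _) _ => //.
  rewrite limn_einf_lim; apply: lime_le; first exact: is_cvg_einfs.
  apply: nearW => k; apply: le_trans (fM k).
  by apply: ereal_inf_lbound; exists k => /=.
apply: filterS (integrable_ae _ intf) => // x /(_ I) + h.
by have [-> _] := cvg_limn_einf_sup h.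
Qed.

Section Counting.
Variables (R : realType) (n : nat).
Notation U := (borel_unitary R n.+1).

Definition net_index K := {ffun 'I_n -> 'I_((mesh n K).*2.+1) * bool}.

Definition thin_event K (f : net_index K) : set U :=
  [set A | thin_torus (thickness R n K) (unitary_mx A *m net_vec R f)].

(** The shift to [K.+1] meets the positivity conditions on K for every index of the sequence. *)
Definition thin_count K (A : U) : \bar R :=
  (\sum_(f : net_index K.+1) (\1_(thin_event f) A)%:E)%E.

Lemma measurable_thin_event K (f : net_index K) : measurable (thin_event f).
Proof. exact: measurable_thin_torus. Qed.

Lemma thin_count_measurable K : measurable_fun setT (@thin_count K).
Proof.
apply: emeasurable_sum => f; apply/measurable_EFinP; apply: measurable_indic.
exact: measurable_thin_event.
Qed.

(** With m = mesh = L (K + 1) there are (2 (2 m + 1))^n <= (6 m)^n cells, each of probability at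
    most C (K + 1)^-n, so the powers of K + 1 cancel. *)
Lemma thin_count_integral (mu : probability U R) : is_haar mu ->
  exists M : R, forall K, (\int[mu]_A thin_count K A <= M%:E)%E.
Proof.
move=> mu_haar; have [C [C0 hC]] := @thin_torus_measure R n.
pose L : R := (4320 * n.+1 ^ 2)%:R.
exists ((6 * L) ^+ n * C) => K.
have mind (f : net_index K.+1) :
    measurable_fun setT (fun A : U => ((\1_(thin_event f) A)%:E : \bar R)).
  apply/measurable_EFinP; apply: measurable_indic.
  exact: measurable_thin_event.
rewrite ge0_integral_sum//.
have le1 (f : net_index K.+1) :
    (\int[mu]_A (\1_(thin_event f) A)%:E <= ((K.+1%:R ^+ n)^-1 * C)%:E)%E.
  rewrite integral_indic//; last exact: measurable_thin_event.
  by rewrite setIT; exact: hC.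
apply: le_trans (lee_sum _ (fun f _ => le1 f)) _.
rewrite sumEFin lee_fin sumr_const -[leLHS]mulr_natl.
rewrite card_ffun card_prod card_ord card_bool card_ord natrX.
rewrite mulrA ler_wpM2r// -exprVn -exprMn lerXn2r ?nnegrE//.
  by rewrite mulr_ge0.
rewrite ler_pdivrMr//.
have -> : 6 * L * K.+1%:R = (6 * mesh n K.+1)%:R.
  by rewrite /L /mesh !natrM; ring.
by rewrite ler_nat /mesh; lia.
Qed.

(** If both points lie in the cell of one centre, their real and imaginary parts differ by at most 4
    / mesh each, so e <= 8 / mesh <= 8 / (K + 1), which fails for large K. *)
Lemma near_separated (w w' : 'cV[R[i]]_n.+1) : w <> w' ->
  \forall K \near \oo, forall f : net_index K.+1,
    ~ (forall i, (`|re (w i 0 - net_vec R f i 0)| <= 2 / (mesh n K.+1)%:R /\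
                  `|im (w i 0 - net_vec R f i 0)| <= 2 / (mesh n K.+1)%:R) /\
                 (`|re (w' i 0 - net_vec R f i 0)| <= 2 / (mesh n K.+1)%:R /\
                  `|im (w' i 0 - net_vec R f i 0)| <= 2 / (mesh n K.+1)%:R)).
Proof.
move=> ww'.
have [i wi] : exists i, w i 0 != w' i 0.
  apply: contrapT => /forallNP h; apply: ww'; apply/matrixP => i j.
  by rewrite ord1; apply/eqP; apply: contrapT => /negP; exact: h.
pose e := `|re (w i 0 - w' i 0)| + `|im (w i 0 - w' i 0)|.
have e0 : 0 < e.
  rewrite lt_neqAle addr_ge0// andbT eq_sym paddr_eq0// !normr_eq0.
  apply: contra wi; rewrite -(subr_eq0 (w i 0)) => /andP[/eqP h1 /eqP h2].
  by rewrite eq_complex h1 h2 !eqxx.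
have e80 : 0 < e / 8 by rewrite divr_gt0.
near=> K => f /(_ i)[[h1 h2] [h3 h4]].
have : K.+1%:R^-1 < e / 8.
  by near: K; exact: (near_infty_natSinv_lt (PosNum e80)).
apply/negP; rewrite -leNgt.
have meshK : ((mesh n K.+1)%:R : R)^-1 <= K.+1%:R^-1.
  by rewrite lef_pV2 ?posrE ?ltr0n ?ler_nat// /mesh; nia.
move: h1 h2 h3 h4; rewrite !raddfB/= => h1 h2 h3 h4.
have tri (a b c d : R) : `|a - c| <= d -> `|b - c| <= d -> `|a - b| <= 2 * d.
  rewrite !ler_norml => /andP[? ?] /andP[? ?]; apply/andP; split; lra.
have := tri _ _ _ _ h1 h3; have := tri _ _ _ _ h2 h4.
rewrite /e !raddfB/=.
move: meshK; set m := (_%:R)^-1; set p := (_%:R)^-1.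
by move=> ? ? ?; lra.
Unshelve. all: by end_near.
Qed.

(** More than M points of [Bi] are selected. Once K is large enough to separate them pairwise, they
    lie in distinct cells, and each of these cells is counted. *)
Lemma thin_count_cvg (A : unitary_group R n.+1) :
  infinite_set (Bi (unitary_mx A)) -> thin_count ^~ A @ \oo --> +oo%E.
Proof.
move=> infB; apply/cvgeyPge => M.
have [B BBi Bsize] := infinite_set_fset (Num.truncn M).+1 infB.
set s := finmap.enum_fset B in Bsize.
have us : uniq s by exact: finmap.fset_uniq.
have sep : \forall K \near \oo, forall i j : 'I_(size s), i != j ->
    forall f : net_index K.+1,
    ~ (forall l, (`|re (s`_i l 0 - net_vec R f l 0)| <= 2 / (mesh n K.+1)%:R /\
                  `|im (s`_i l 0 - net_vec R f l 0)| <= 2 / (mesh n K.+1)%:R) /\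
                 (`|re (s`_j l 0 - net_vec R f l 0)| <= 2 / (mesh n K.+1)%:R /\
                  `|im (s`_j l 0 - net_vec R f l 0)| <= 2 / (mesh n K.+1)%:R)).
  apply: filter_forall => i; apply: filter_forall => j.
  have [->|ij] := eqVneq i j; first exact: nearW.
  have : s`_i <> s`_j.
    by move=> /eqP; rewrite nth_uniq// => /eqP/val_inj/eqP; apply/negP.
  by move=> /near_separated; apply: filterS => K h _.
apply: filterS sep => K sep.
have mesh0 : (0 < mesh n K.+1)%N by rewrite /mesh !muln_gt0.
have sBi (i : 'I_(size s)) : Bi (unitary_mx A) s`_i.
  by apply: BBi => /=; exact: mem_nth.
have [r hr] := choice (fun i => Bi_net_vec mesh0 (sBi i)).
have r_inj : injective r.
  move=> i j rij; apply/eqP; apply: contrapT => /negP ij.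
  by apply: (sep i j ij (r i)) => l; split; [exact: hr|rewrite rij; exact: hr].
have rA i : thin_event (r i) A.
  by apply: (thin_torus_net_vec _ (unitary_mxP A) (sBi i)) => //; exact: hr.
rewrite /thin_count sumEFin lee_fin.
have -> : \sum_(f : net_index K.+1) \1_(thin_event f) A =
    #|[set f : net_index K.+1 | A \in thin_event f]%SET|%:R :> R.
  rewrite -sum1_card natr_sum [RHS]big_mkcond/=; apply: eq_bigr => f _.
  by rewrite inE indicE; case: (_ \in _).
apply: le_trans (ltW (truncnS_gt M)) _; rewrite ler_nat.
apply: leq_trans Bsize _; rewrite -[X in (X <= _)%N]card_ord -(card_imset _ r_inj).
apply: subset_leq_card; apply/fintype.subsetP => f /imsetP[i _ ->].
by rewrite inE; exact/mem_set/rA.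
Qed.

End Counting.

Theorem proposition9p11 (R : realType) (n : nat)
    (mu : probability (borel_unitary R n.+1) R) (mu_haar : is_haar mu) :
  {ae mu, forall A : unitary_group R n.+1, finite_set (Bi (unitary_mx A))}.
Proof.
have [M hM] := thin_count_integral mu_haar.
have thin0 K (A : borel_unitary R n.+1) : (0 <= thin_count K A)%E.
  by apply: sume_ge0 => f _; rewrite lee_fin.
have := ae_not_cvg_pinfty (@thin_count_measurable R n) thin0 hM.
apply: filterS => A hA; apply: contrapT => infB.
exact/hA/thin_count_cvg.
Qed.
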